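(* Let $\mathcal{O}$ be a discrete valuation ring with maximal ideal $\mathfrak{p}$ and finite residue field of characteristic $p\neq 2$. Let $r\geq 1$, let $\mathcal{O}_r=\mathcal{O}/\mathfrak{p}^r$, and let $G=\mathrm{GL}_2(\mathcal{O}_r)$ or $G=\mathrm{SL}_2(\mathcal{O}_r)$. Then every irreducible complex character $\rho\in\mathrm{Irr}(G)$ that is trivial on the centre of $G$ is contained in the conjugation character of $G$.
   Context: For a finite group $G$, $\mathrm{Irr}(G)$ is the set of irreducible complex characters. The conjugation character of $G$ is the character of the complex permutation representation of $G$ given by the action of $G$ on itself by conjugation. A character $\rho$ is contained in it if $\rho$ is one of its irreducible constituents. A character $\rho$ is trivial on a subgroup $H$ if $H\subseteq\ker\rho$, i.e. $\rho(h)=\rho(1)$ for all $h\in H$. *)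

(* Defs.v *)
From HB Require Import structures.
From mathcomp Require Import all_boot all_algebra all_fingroup all_solvable.
From mathcomp Require Import all_field all_character.
From mathcomp Require Import generic_quotient ring_quotient.
From mathcomp Require Import boolp classical_sets cardinality.

Set Implicit Arguments.
Unset Strict Implicit.
Unset Printing Implicit Defensive.

Import GRing.Theory.
Local Open Scope ring_scope.
Local Open Scope quotient_scope.

(* The elements of [idealr O] are the proper ideals of O: the unit ideal is    *)
(* excluded by [idealr]. They are boolean predicates; by boolp.asbool this is  *)
(* no restriction. *)
Section DVR.
Variable O : idomainType.

Definition principal_ideal (I : idealr O) : Prop :=
  exists a, forall x, x \in I <-> exists y, x = y * a.

Definition maximal_ideal (I : idealr O) : Prop :=
  forall J : idealr O, {subset I <= J} -> I =i J.

(* A principal ideal domain whose only maximal ideal is m, with m nonzero. *)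
Definition is_dvr (m : idealr O) : Prop :=
  [/\ forall I : idealr O, principal_ideal I,
      maximal_ideal m,
      forall n : idealr O, maximal_ideal n -> n =i m
    & exists2 x, x \in m & x != 0].

Definition finite_residue (m : idealr O) : Prop :=
  finite_set [set: {ideal_quot m}].

End DVR.

Section IdealPower.
Variables (O : idomainType) (m : idealr O) (r : nat).

(* The ideal generated by the products of r elements of m. The unused proof    *)
(* 0 < r makes the power a proper ideal. *)
Definition in_ideal_pow (hr : (0 < r)%N) : O -> bool := fun x =>
  `[< exists s : seq (O * r.-tuple O),
        (forall t, t \in s -> all [in m] t.2)
        /\ x = \sum_(t <- s) t.1 * \prod_(a <- t.2) a >].

Hypothesis hr : (0 < r)%N.

Lemma ideal_pow_sub x : in_ideal_pow hr x -> x \in m.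
Proof.
move=> /asboolP[s [sm ->]]; rewrite big_seq; apply: rpred_sum => t /sm.
apply: contraTT => tm; case: t tm => c [[|a t] /= szt].
  by move: hr; rewrite -(eqP szt).
by rewrite big_cons mulrCA mulrC => tm; apply/negP => /andP[am _];
  rewrite idealMr in tm.
Qed.

Lemma ideal_pow_closed : idealr_closed (in_ideal_pow hr).
Proof.
split.
- by apply/asboolP; exists [::]; rewrite big_nil.
- by apply/negP => /ideal_pow_sub; rewrite idealr1.
- move=> c x y /asboolP[s [sm ->]] /asboolP[t [tm ->]]; apply/asboolP.
  exists ([seq (c * u.1, u.2) | u <- s] ++ t); split.
    by move=> u; rewrite mem_cat => /orP[/mapP[v vs ->]|/tm//]; exact: (sm v).
  rewrite big_cat big_map mulr_sumr /=; congr (_ + _).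
  by apply: eq_bigr => u _; rewrite mulrA.
Qed.

HB.instance Definition _ := isIdealr.Build O (in_ideal_pow hr) ideal_pow_closed.

Definition ideal_pow : idealr O := in_ideal_pow hr.

End IdealPower.

(* O / m^r. The proofs in the type are used by the instances below. *)
Definition dvr_quot (O : idomainType) (m : idealr O) (hO : is_dvr m)
  (hfin : finite_residue m) (r : nat) (hr : (0 < r)%N) : Type :=
  {ideal_quot ideal_pow m hr}.

Section DvrQuot.
Variables (O : idomainType) (m : idealr O) (hO : is_dvr m).
Variables (hfin : finite_residue m) (r : nat) (hr : (0 < r)%N).

Local Notation Or := (dvr_quot hO hfin hr).

HB.instance Definition _ := GRing.ComNzRing.copy Or {ideal_quot ideal_pow m hr}.

Lemma dvr_quot_finite : exists s : seq Or, forall x, x \in s.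
Proof.
have [pid _ _ _] := hO; have [a ma] := pid m.
have am : a \in m by apply/ma; exists 1; rewrite mul1r.
have [s sE] : exists s : seq O, forall x, exists2 y, y \in s & x - y \in m.
  have /finite_seqP[s sE] := hfin; exists (map repr s) => x.
  exists (repr (\pi_{ideal_quot m} x)).
    apply: map_f; have : [set: {ideal_quot m}]%classic (\pi x) by [].
    by rewrite sE.
  by rewrite Quotient.idealrBE reprK.
have [t tE] : exists t : seq O, forall x,
    exists2 y, y \in t & exists c, x - y = c * a ^+ r.
  elim: (r) => [|n [t tE]].
    by exists [:: 0] => x; exists 0; rewrite ?mem_head//; exists x;
      rewrite mulr1 subr0.
  exists [seq y + z * a ^+ n | y <- t, z <- s] => x.
  have [y yt [c xy]] := tE x; have [z zs /ma[d cz]] := sE c.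
  exists (y + z * a ^+ n); first by apply/allpairsP; exists (y, z).
  exists d; rewrite opprD addrA xy -mulrBl cz exprS mulrA //.
exists (map \pi_{ideal_quot ideal_pow m hr} t) => x.
have [y yt [c xy]] := tE (repr x).
suff -> : x = \pi_{ideal_quot ideal_pow m hr} y by exact: map_f.
rewrite -[LHS]reprK; apply/eqP; rewrite -Quotient.idealrBE xy.
apply/asboolP; exists [:: (c, [tuple of nseq r a])]; split.
  by move=> u; rewrite inE => /eqP-> /=; rewrite all_nseq am orbT.
by rewrite big_seq1 /= big_nseq -Monoid.iteropE.
Qed.

Definition dvr_quot_enum : seq Or := undup (sval (cid dvr_quot_finite)).

Lemma mem_dvr_quot_enum x : x \in dvr_quot_enum.
Proof. by rewrite mem_undup; exact: (svalP (cid dvr_quot_finite)). Qed.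

Lemma dvr_quot_enumK : pcancel (fun x => index x dvr_quot_enum) (onth dvr_quot_enum).
Proof.
move=> x; apply/eqP; rewrite onthE (nth_map x) ?index_mem ?mem_dvr_quot_enum//.
by rewrite nth_index ?mem_dvr_quot_enum.
Qed.

HB.instance Definition _ : isCountable Or := PCanIsCountable dvr_quot_enumK.

Lemma dvr_quot_enumP : Finite.axiom dvr_quot_enum.
Proof. by move=> x; rewrite count_uniq_mem ?undup_uniq ?mem_dvr_quot_enum. Qed.

HB.instance Definition _ := isFinite.Build Or dvr_quot_enumP.
HB.instance Definition _ := FinRing.isNzRing.Build Or.

End DvrQuot.

Section SpecialLinear.
Variables (n : nat) (R : finComUnitRingType).

Definition SLgroup : {set {'GL_n[R]}} := [set u | \det (GLval u) == 1].

Lemma SLgroup_set : group_set SLgroup.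
Proof.
apply/group_setP; split=> [|u v]; first by rewrite inE GL_1E det1.
by rewrite !inE GL_ME det_mulmx => /eqP-> /eqP->; rewrite mulr1.
Qed.
Canonical SLgroup_group := Group SLgroup_set.

End SpecialLinear.

Notation "''SL_' n [ R ]" := (SLgroup n R)
  (at level 0, n at level 2, format "''SL_' n [ R ]") : group_scope.
Notation "''SL_' n [ R ]" := (SLgroup_group n R) : Group_scope.

Section ConjugationCharacter.
Variables (gT : finGroupType) (G : {group gT}).

(* The basis vector indexed by x is sent to the one indexed by                 *)
(* x ^ g = g^-1 * x * g; matrices act on row vectors, as in [regular_mx]. *)
Definition conj_mx (g : gT) : 'M[algC]_#|G| :=
  \matrix_i delta_mx 0 (gring_index G (enum_val i ^ g)).

Lemma conj_mx_repr : mx_repr G conj_mx.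
Proof.
split=> [|x y Gx Gy]; apply/row_matrixP=> i; rewrite !rowK.
  by rewrite conjg1 row1 gring_valK.
by rewrite row_mul rowK -rowE rowK conjgM gring_indexK // groupJ ?enum_valP.
Qed.
Canonical conj_repr := MxRepresentation conj_mx_repr.

Definition conj_char : 'CF(G) := cfRepr conj_repr.

End ConjugationCharacter.

(* Main.v *)
Require Import Defs.
From HB Require Import structures.
From mathcomp Require Import all_boot all_order all_algebra all_fingroup all_solvable.
From mathcomp Require Import all_field all_character.
From mathcomp Require Import ring_quotient.
From mathcomp Require Import boolp generic_quotient ring.

(** The multiplicity of an irreducible character chi in the conjugation
    character of G is the sum over classes of x of the multiplicity of the
    trivial character in the restriction of chi to C_G(x). So it suffices to
    find one x in G such that S(C_G(x)) > 0, where S(H) is the sum of chi over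
    H; recall that S(H) >= 0 for every subgroup H ([conj_char_cent1]).

    Let R = O/p^r with uniformizer pi and socle generator s = pi^(r-1), and
    send a matrix A = (a, b; c, d) to the vector v(A) = (b, c, a - d), which
    determines A modulo scalars. Two matrices commute exactly when the wedge
    product of their vectors vanishes ([comm_wedge]). Call u in R^3 primitive
    if one of its coordinates is a unit, and let T_u be the set of g in G
    with u /\ v(g) = 0. Summing over all primitive u,

      sum_u S(T_u) = sum_(g in G) chi(g) N(v(g)),

    where N(v) is the number of primitive u with u /\ v = 0. As GL_3(R) is
    transitive on primitive vectors, N(v) depends only on the largest k such
    that pi^k divides v, and it increases with k. Abel summation
    ([num_parallelE]) rewrites the right hand side as a combination with
    nonnegative coefficients of the sums S(G_k), where G_k is the subgroup of
    the elements of G that are scalar modulo pi^k. The coefficient of S(G_r)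
    is positive, and S(G_r) > 0 because G_r is central and chi is trivial on
    the centre. Hence some S(T_u) is positive ([sum_parallel_gt0]), and the
    theorem follows whenever each T_u is the centralizer of an element of G.

    This is so for GL_2 ([GL_centralizer]). For SL_2 one needs an element of
    determinant 1 in R + R A, where v(A) = u, that generates it modulo
    scalars. With disc u = bc + (e/2)^2 for u = (b, c, e), the rational
    parametrization of the conic t^2 - disc(u) l^2 = 1 gives one
    ([SL_centralizer]) as soon as 1 - disc(u) m^2 is a unit for some unit m.
    Such an m exists for every u if the residue field has more than three
    elements.

    There remains SL_2 with residue field F_3, where T_u is known to be a
    centralizer only for the good u, those with disc u <> 1 modulo pi. Let
    K = G_(r-1). If S(K) > 0, the summation applies with pi u in place of u,
    as all the groups of g with pi (u /\ v(g)) = 0 are centralizers.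
    Otherwise S(K) = 0 and, by Schur's lemma, chi sums to zero over every
    coset of K ([coset_sum_irr]). Since the number of good u with
    u /\ v(g) = 0 is constant on each coset of K other than K
    ([num_good_parallel_coset]), the sum of S(T_u) over the good u equals
    that of S(T_u :&: K). For r >= 2 the group K is abelian, and one of these
    is positive: given a linear constituent lambda of the restriction of chi
    to K, the map w |-> lambda(1 + s M(w)), where M(w) is the matrix of trace
    zero with vector w, is a homomorphism from R^3 to the cube roots of unity,
    and it is trivial on one of six explicit good vectors
    ([exists_good_trivial]). For r = 1 the sum over the good u is evaluated
    directly. *)

Set Implicit Arguments.
Unset Strict Implicit.
Unset Printing Implicit Defensive.

Import GRing.Theory Num.Theory Order.TTheory.
Local Open Scope ring_scope.

(** * Sums of a character over subgroups *)

Section CharSums.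
Variables (gT : finGroupType) (G : {group gT}).

Lemma sum_char_cfdot (H : {group gT}) (chi : 'CF(G)) : H \subset G ->
  \sum_(x in H) chi x = #|H|%:R * '['Res[H] chi, 1].
Proof.
move=> sHG; rewrite cfdotE mulrA mulfV ?neq0CG // mul1r.
apply: eq_bigr => x Hx; rewrite cfun1E Hx rmorph1 mulr1 cfResE //.
Qed.

Lemma sum_char_ge0 (H : {group gT}) (chi : 'CF(G)) : H \subset G ->
  chi \is a character -> 0 <= \sum_(x in H) chi x.
Proof.
move=> sHG Nchi; rewrite sum_char_cfdot // mulr_ge0 ?ler0n //.
by rewrite natr_ge0 // Cnat_cfdot_char ?cfRes_char ?rpred1.
Qed.

Lemma sum_char_gt0 (H : {group gT}) (chi : 'CF(G)) : H \subset G ->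
  chi \is a character -> 0 \in irr_constt ('Res[H] chi) ->
  0 < \sum_(x in H) chi x.
Proof.
move=> sHG Nchi; rewrite irr_consttE irr0 => nz.
rewrite lt_def sum_char_ge0 // andbT sum_char_cfdot // mulf_neq0 //.
exact: neq0CG.
Qed.

Lemma sum_char_triv (H : {group gT}) (chi : 'CF(G)) :
  chi \is a character -> chi != 0 -> H \subset cfker chi ->
  0 < \sum_(x in H) chi x.
Proof.
move=> Nchi nz sHk; rewrite (eq_bigr (fun _ => chi 1%g)) => [|x Hx].
  by rewrite sumr_const pmulrn_lgt0 ?cardG_gt0 // char1_gt0.
by rewrite cfker1 // (subsetP sHk).
Qed.

Lemma conj_charE g : g \in G -> conj_char G g = #|'C_G[g]%g|%:R.
Proof.
move=> Gg; rewrite cfunE Gg mulr1n /mxtrace.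
rewrite (eq_bigr (fun i => (enum_val i \in 'C_G[g]%g)%:R)).
  rewrite -(big_enum_val (fun x => (x \in 'C_G[g]%g)%:R)) /=.
  rewrite -sum1_card natr_sum big_mkcond [RHS]big_mkcond; apply: eq_bigr => x _.
  by rewrite inE; case: (x \in G); case: (x \in 'C[g]%g).
move=> i _; rewrite !mxE eqxx /= inE enum_valP /=; congr (nat_of_bool _)%:R.
rewrite -[X in X == _](gring_valK i) eq_sym.
rewrite (can_in_eq (@gring_indexK _ G)) ?groupJ ?enum_valP //.
rewrite (sameP cent1P commgP); exact: (sameP eqP conjg_fixP).
Qed.

(** The multiplicity of chi_i in the conjugation character is the average over
    x in G of the nonnegative sums of chi_i over C_G(x), so if it vanishes then
    all these sums do. *)
Lemma conj_char_cent1 i x : i \notin irr_constt (conj_char G) -> x \in G ->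
  \sum_(g in 'C_G[x]%g) 'chi[G]_i g = 0.
Proof.
rewrite irr_consttE negbK => /eqP nz Gx.
have ge0 y : 0 <= \sum_(g in 'C_G[y]%g) 'chi[G]_i g.
  by apply: sum_char_ge0; rewrite ?subsetIl ?irr_char.
move: x Gx; apply: psumr_eq0P => [y _|]; first exact: ge0.
have: '['chi_i, conj_char G] = 0 by rewrite cfdotC nz rmorph0.
rewrite cfdotE => /eqP; rewrite mulf_eq0 invr_eq0 (negPf (neq0CG _)) /=.
have -> : \sum_(g in G) 'chi_i g * (conj_char G g)^* =
    \sum_(g in G) \sum_(y in G | y \in 'C[g]%g) 'chi_i g.
  apply: eq_bigr => g Gg; rewrite conj_charE // conjC_nat mulr_natr -sumr_const.
  by apply: eq_bigl => y; rewrite inE.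
rewrite (exchange_big_dep [in G]) /= => [/eqP e0|g y Gg /andP[] //].
rewrite -[RHS]e0; apply: eq_bigr => y Gy; apply: eq_bigl => g.
by rewrite in_setI Gy /= cent1C.
Qed.

(** The sum of the representation over K is a scalar matrix by Schur's lemma,
    and its trace is zero. *)
Lemma coset_sum_irr i (K : {group gT}) g : (K <| G)%g -> g \in G ->
  \sum_(k in K) 'chi[G]_i k = 0 -> \sum_(k in K) 'chi_i (g * k)%g = 0.
Proof.
move=> nKG Gg; have sKG := normal_sub nKG.
set rG := 'Chi_i; pose e := \sum_(k in K) rG k.
have chiE x : x \in G -> 'chi_i x = \tr (rG x).
  by move=> Gx; rewrite -irrRepr cfunE Gx.
have -> : \sum_(k in K) 'chi_i k = \tr e.
  by rewrite /e raddf_sum; apply: eq_bigr => k /(subsetP sKG); exact: chiE.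
move=> tr0; suff e0 : e = 0.
  transitivity (\tr (rG g *m e)); last by rewrite e0 mulmx0 mxtrace0.
  rewrite /e mulmx_sumr raddf_sum; apply: eq_bigr => k /(subsetP sKG) Gk.
  by rewrite -repr_mxM // chiE // groupM.
have : is_scalar_mx e.
  apply: (@mx_abs_irr_cent_scalar _ _ _ _ rG _); first exact/groupC/socle_irr.
  apply/centgmxP => x Gx; rewrite /e mulmx_suml mulmx_sumr.
  rewrite [RHS](reindex_acts 'J _ Gx) ?astabsJ ?normal_norm //=.
  apply: eq_bigr => k Kk; have Gk := subsetP sKG k Kk.
  by rewrite -!repr_mxM ?groupJ // /conjg mulKVg.
case/is_scalar_mxP => a ea; move: tr0; rewrite ea mxtrace_scalar.
move/eqP; rewrite -mulr_natr mulf_eq0 pnatr_eq0 => /orP[/eqP->|].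
  by rewrite raddf0.
by rewrite eqn0Ngt irr_degree_gt0.
Qed.

(** A constituent of the restriction to K whose kernel contains H contributes
    H-fixed vectors. *)
Lemma sum_char_constt (K H : {group gT}) (chi : 'CF(G)) (j : Iirr K) :
    chi \is a character -> K \subset G -> H \subset K ->
    j \in irr_constt ('Res[K] chi) -> H \subset cfker 'chi_j ->
  0 < \sum_(h in H) chi h.
Proof.
move=> Nchi sKG sHK jK Hj; apply: sum_char_gt0 => //;
  first exact: subset_trans sKG.
rewrite -(cfResRes _ sHK sKG).
apply: (constt_Res_trans (cfRes_char K Nchi) jK).
have -> : 'Res[H] 'chi_j = ('chi_j 1%g)%:A.
  apply/cfun_inP => h Hh; rewrite cfResE // cfunE cfun1E Hh mulr1.
  by rewrite cfker1 // (subsetP Hj).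
rewrite irr_consttE irr0 cfdotZl cfnorm1 mulr1; exact: irr1_neq0.
Qed.

(** A weight that is constant on the cosets of K other than K itself makes no
    contribution outside K. *)
Lemma sum_coset_const i (K : {group gT}) (F : gT -> nat) :
    (K <| G)%g -> \sum_(k in K) 'chi[G]_i k = 0 ->
    (forall g k, g \in G -> g \notin K -> k \in K -> F (g * k)%g = F g) ->
  \sum_(g in G :\: K) 'chi_i g *+ F g = 0.
Proof.
move=> nKG SK0 FK; have sKG := normal_sub nKG.
suff /eqP : (\sum_(g in G :\: K) 'chi_i g *+ F g) *+ #|K| = 0.
  by rewrite mulrn_eq0 eqn0Ngt cardG_gt0 => /eqP.
rewrite -sumr_const.
have reK k : k \in K -> \sum_(g in G :\: K) 'chi_i g *+ F g =
    \sum_(g in G :\: K) 'chi_i (g * k)%g *+ F g.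
  move=> Kk; have Gk := subsetP sKG k Kk.
  rewrite (reindex_inj (mulIg k)) /=; apply: eq_big => [g|g /setDP[Gg nKg]].
    by rewrite !inE !groupMr.
  by rewrite FK //; move: Gg nKg; rewrite !groupMr.
rewrite (eq_bigr _ reK) exchange_big /= big1 // => g /setDP[Gg _].
by rewrite sumrMnl (coset_sum_irr nKG Gg SK0) mul0rn.
Qed.
End CharSums.

(** * Two by two matrices modulo scalars *)

Section TwoByTwo.
Variable R : comUnitRingType.

Lemma mulmx2E (A B : 'M[R]_2) i j :
  (A *m B) i j = A i 0 * B 0 j + A i 1 * B 1 j.
Proof.
rewrite mxE !big_ord_recl big_ord0 addr0.
by rewrite (_ : lift ord0 ord0 = 1) //; apply: val_inj.
Qed.

Lemma matrix2P (A B : 'M[R]_2) : A 0 0 = B 0 0 -> A 0 1 = B 0 1 ->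
  A 1 0 = B 1 0 -> A 1 1 = B 1 1 -> A = B.
Proof.
move=> h00 h01 h10 h11; apply/matrixP.
have ord2 (i : 'I_2) : i = 0 \/ i = 1.
  by case: i => [[|[|//]] ?]; [left|right]; apply: val_inj.
by move=> i j; case: (ord2 i) => ->; case: (ord2 j) => ->.
Qed.

Lemma ord3P (i : 'I_3) : [\/ i = 0, i = 1 | i = 2%:R].
Proof.
case: i => [[|[|[|//]]] ?]; [apply: Or31|apply: Or32|apply: Or33];
  exact: val_inj.
Qed.

Lemma row3P (u v : 'rV[R]_3) : u 0 0 = v 0 0 -> u 0 1 = v 0 1 ->
  u 0 2%:R = v 0 2%:R -> u = v.
Proof. by move=> h0 h1 h2; apply/rowP => i; case: (ord3P i) => ->. Qed.

(** The matrix (a, b; c, d). *)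
Definition mx2 (a b c d : R) : 'M[R]_2 :=
  \matrix_(i, j) (nth [::] [:: [:: a; b]; [:: c; d]] i)`_j.

Lemma det_mx2 a b c d : \det (mx2 a b c d) = a * d - b * c.
Proof.
rewrite (expand_det_row _ 0) !big_ord_recl big_ord0 addr0 /cofactor !det_mx11
  !mxE /=.
by rewrite !expr0 expr1; ring.
Qed.

Lemma det2E (A : 'M[R]_2) : \det A = A 0 0 * A 1 1 - A 0 1 * A 1 0.
Proof.
rewrite -det_mx2; congr (\det _).
by apply: matrix2P; rewrite !mxE.
Qed.

(** The coordinates (b, c, a - d) of the class of (a, b; c, d) modulo scalar
    matrices. *)
Definition vec (A : 'M[R]_2) : 'rV[R]_3 :=
  \row_i [:: A 0 1; A 1 0; A 0 0 - A 1 1]`_i.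

Lemma vecE A : ((vec A 0 0 = A 0 1) * (vec A 0 1 = A 1 0)
  * (vec A 0 2%:R = A 0 0 - A 1 1))%type.
Proof. by rewrite !mxE. Qed.

(** The matrix of the minors u_i v_j - v_i u_j. *)
Definition wedge (u v : 'rV[R]_3) : 'M[R]_3 := u^T *m v - v^T *m u.

Lemma wedgeE u v i j : wedge u v i j = u 0 i * v 0 j - v 0 i * u 0 j.
Proof. by rewrite !mxE !big_ord1 !mxE. Qed.

Lemma wedgeC u v : - wedge u v = wedge v u.
Proof. by rewrite /wedge opprB. Qed.

Lemma wedge0r u : wedge u 0 = 0.
Proof. by rewrite /wedge mulmx0 trmx0 mul0mx subr0. Qed.

Lemma wedgeZr c u v : wedge u (c *: v) = c *: wedge u v.
Proof. by rewrite /wedge -scalemxAr linearZ -scalemxAl -scalerBr. Qed.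

Lemma wedgeZl c u v : wedge (c *: u) v = c *: wedge u v.
Proof. by rewrite /wedge -scalemxAr linearZ -scalemxAl -scalerBr. Qed.

Lemma wedge_mul u v M : wedge (u *m M) (v *m M) = M^T *m wedge u v *m M.
Proof. by rewrite /wedge !trmx_mul mulmxBr mulmxBl !mulmxA. Qed.

Lemma wedge_mul_eq0 u v M : M \in unitmx ->
  (wedge (u *m M) (v *m M) == 0) = (wedge u v == 0).
Proof.
move=> UM; rewrite wedge_mul; apply/eqP/eqP => [|->];
  last by rewrite mulmx0 mul0mx.
move/(congr1 (fun A => A *m invmx M)); rewrite mul0mx mulmxK //.
move/(congr1 (fun A => invmx M^T *m A)); rewrite mulmx0 mulKmx //.
by rewrite unitmx_tr.
Qed.

(* [ring] treats the entries as atoms only up to syntax, so they are abstracted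
   first. *)
Ltac mx2_ring A B :=
  let a0 := fresh in set a0 := A 0 0; let a1 := fresh in set a1 := A 0 1;
  let a2 := fresh in set a2 := A 1 0; let a3 := fresh in set a3 := A 1 1;
  let b0 := fresh in set b0 := B 0 0; let b1 := fresh in set b1 := B 0 1;
  let b2 := fresh in set b2 := B 1 0; let b3 := fresh in set b3 := B 1 1;
  ring.

Lemma comm_wedge (A B : 'M[R]_2) :
  A *m B = B *m A <-> wedge (vec A) (vec B) = 0.
Proof.
split=> [AB|w0].
  have E i j : (A *m B) i j = (B *m A) i j by rewrite AB.
  have e00 : A 0 1 * B 1 0 - A 1 0 * B 0 1 = 0.
    by have /eqP := E 0 0; rewrite !mulmx2E -subr_eq0 => /eqP<-; mx2_ring A B.
  have e01 : A 0 1 * (B 0 0 - B 1 1) - B 0 1 * (A 0 0 - A 1 1) = 0.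
    by have /esym/eqP := E 0 1; rewrite !mulmx2E -subr_eq0 => /eqP<-;
      mx2_ring A B.
  have e10 : A 1 0 * (B 0 0 - B 1 1) - B 1 0 * (A 0 0 - A 1 1) = 0.
    by have /eqP := E 1 0; rewrite !mulmx2E -subr_eq0 => /eqP<-; mx2_ring A B.
  apply/matrixP => i j; rewrite wedgeE [RHS]mxE.
  have aux e : e = 0 -> - e = 0 :> R by move=> ->; rewrite oppr0.
  case: (ord3P i) => ->; case: (ord3P j) => ->; rewrite !vecE;
    first [ mx2_ring A B | rewrite -e00; mx2_ring A B
          | rewrite -e01; mx2_ring A B | rewrite -e10; mx2_ring A B
          | rewrite -(aux _ e00); mx2_ring A B
          | rewrite -(aux _ e01); mx2_ring A B
          | rewrite -(aux _ e10); mx2_ring A B].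
have E i j := congr1 (fun M : 'M_3 => M i j) w0.
have := E 0 1; have := E 0 2%:R; have := E 1 2%:R.
rewrite !wedgeE !vecE !mxE => /subr0_eq E12 /subr0_eq E02 /subr0_eq E01.
apply: matrix2P; rewrite !mulmx2E; apply/eqP; rewrite -subr_eq0; apply/eqP.
- transitivity (A 0 1 * B 1 0 - B 0 1 * A 1 0); first by mx2_ring A B.
  by rewrite E01 subrr.
- transitivity (B 0 1 * (A 0 0 - A 1 1) - A 0 1 * (B 0 0 - B 1 1));
    first by mx2_ring A B.
  by rewrite E02 subrr.
- transitivity (A 1 0 * (B 0 0 - B 1 1) - B 1 0 * (A 0 0 - A 1 1));
    first by mx2_ring A B.
  by rewrite E12 subrr.
- transitivity (B 0 1 * A 1 0 - A 0 1 * B 1 0); first by mx2_ring A B.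
  by rewrite E01 subrr.
Qed.

Lemma vec_scalar a : vec (a%:M) = 0 :> 'rV[R]_3.
Proof. by apply: row3P; rewrite !vecE !mxE //= subrr. Qed.

Lemma vecZ a (A : 'M[R]_2) : vec (a *: A) = a *: vec A.
Proof. by apply: row3P; rewrite !mxE //= mulrBr. Qed.

Lemma vecD (A B : 'M[R]_2) : vec (A + B) = vec A + vec B.
Proof. by apply: row3P; rewrite !mxE //=; ring. Qed.

Lemma vec_scale_eq0 c (A : 'M[R]_2) :
  c *: vec A = 0 <-> exists a, c *: A = (c * a)%:M.
Proof.
rewrite -vecZ; split=> [v0|[a ->]]; last exact: vec_scalar.
have E i := congr1 (fun M : 'rV_3 => M 0 i) v0.
have := E 0; have := E 1; have := E 2%:R;
  rewrite !vecE !mxE => /subr0_eq e2 e1 e0.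
by exists (A 1 1); apply: matrix2P; rewrite !mxE ?mulr1n ?mulr0n.
Qed.

End TwoByTwo.

(** * Primitive vectors over a finite uniserial ring *)

Section Uniserial.
Variables (R : finComUnitRingType) (pi : R) (r : nat).

(** Every element of R is a unit times a power of pi, and r is the least
    exponent such that pi ^+ r = 0. *)
Definition uniserial : Prop :=
  [/\ (0 < r)%N, pi ^+ r = 0, pi ^+ r.-1 != 0
    & forall x, exists u k,
        [/\ u \is a GRing.unit, (k <= r)%N & x = u * pi ^+ k]].

Hypothesis hR : uniserial.

(* A generator of the socle of R: multiplying by s is reducing modulo pi. *)
Local Notation s := (pi ^+ r.-1).

Let r_gt0 : (0 < r)%N. Proof. by case: hR. Qed.
Let pir0 : pi ^+ r = 0. Proof. by case: hR. Qed.
Let s_neq0 : s != 0. Proof. by case: hR. Qed.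

Lemma socle_pi : s * pi = 0. Proof. by rewrite -exprSr prednK. Qed.

Lemma socle_piX k : (0 < k)%N -> s * pi ^+ k = 0.
Proof. by case: k => // k _; rewrite exprS mulrA socle_pi mul0r. Qed.

Lemma piX_eq0 k : (pi ^+ k == 0) = (r <= k)%N.
Proof.
apply/idP/idP => [|rk]; last by rewrite -(subnKC rk) exprD pir0 mul0r.
apply: contraTT; rewrite -ltnNge => kr; apply: contraNneq s_neq0 => k0.
have kr1 : (k <= r.-1)%N by rewrite -ltnS prednK.
by rewrite -(subnKC kr1) exprD k0 mul0r.
Qed.

Lemma unit_socle x : (x \is a GRing.unit) = (s * x != 0).
Proof.
apply/idP/idP => [Ux|].
  by apply: contraNneq s_neq0 => sx0; rewrite -(mulrK Ux s) sx0 mul0r.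
have [_ _ _ /(_ x)[u [k [Uu _ ->]]]] := hR.
case: k => [|k]; first by rewrite expr0 mulr1.
by rewrite mulrCA socle_piX // mulr0 eqxx.
Qed.

Lemma nonunitP x : reflect (s * x = 0) (x \isn't a GRing.unit).
Proof. by rewrite unit_socle negbK; apply: eqP. Qed.

Lemma socle_dvd x : pi * x = 0 -> exists y, x = s * y.
Proof.
have [_ _ _ /(_ x)[u [k [Uu _ ->]]]] := hR.
rewrite mulrCA -exprS => /(congr1 (fun y => u^-1 * y)); rewrite mulKr // mulr0.
move/eqP; rewrite piX_eq0 => rk;
  have rk1 : (r.-1 <= k)%N by rewrite -ltnS prednK.
by exists (u * pi ^+ (k - r.-1)); rewrite mulrCA -exprD subnKC.
Qed.

(** Some coordinate of u is a unit; see [primitiveP]. *)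
Definition primitive (u : 'rV[R]_3) := s *: u != 0.

Lemma primitiveP (u : 'rV[R]_3) :
  reflect (exists i, u 0 i \is a GRing.unit) (primitive u).
Proof.
apply: (iffP idP) => [|[i]]; last first.
  by rewrite unit_socle; apply: contraNN => /eqP/rowP/(_ i); rewrite !mxE => ->.
move=> pu; apply/existsP; apply: contraNT pu;
  rewrite negb_exists => /forallP u0.
by apply/eqP/rowP => i; rewrite !mxE; apply/nonunitP.
Qed.

Lemma primitive_mul (u : 'rV[R]_3) M : M \in unitmx ->
  primitive (u *m M) = primitive u.
Proof.
move=> UM; rewrite /primitive scalemxAl; congr negb; apply/eqP/eqP => [|->].
  by move/(congr1 (fun A => A *m invmx M)); rewrite mul0mx mulmxK.
by rewrite mul0mx.
Qed.

Lemma primitiveZ c (u : 'rV[R]_3) : c \is a GRing.unit ->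
  primitive (c *: u) = primitive u.
Proof.
move=> Uc; rewrite /primitive scalerA mulrC -scalerA; congr negb.
by apply/eqP/eqP => [E|->];
  rewrite ?scaler0 // -[LHS]scale1r -(mulVr Uc) -scalerA E scaler0.
Qed.

Lemma piX_primitive k v : primitive v -> (pi ^+ k *: v == 0) = (r <= k)%N.
Proof.
move=> pv; rewrite -piX_eq0; apply/eqP/eqP => [|->]; last by rewrite scale0r.
case/primitiveP: pv => i Uv /rowP/(_ i);
  rewrite !mxE => /(congr1 (fun x => x / v 0 i)).
by rewrite mulrK // mul0r.
Qed.

Lemma vector_factor (v : 'rV[R]_3) : v = 0 \/
  exists k v0, [/\ (k < r)%N, primitive v0 & v = pi ^+ k *: v0].
Proof.
have /fin_all_exists2[k _ kP] i : exists2 k, true & (k <= r)%N /\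
    exists2 u, u \is a GRing.unit & v 0 i = u * pi ^+ k.
  have [_ _ _ /(_ (v 0 i))[u [k [Uu kr E]]]] := hR.
  by exists k => //; split=> //; exists u.
have /fin_all_exists2[u Uu vE] i : exists2 u,
  u \is a GRing.unit & v 0 i = u * pi ^+ k i.
  by case: (kP i).
have [i _ mini] := arg_minnP k (erefl true : xpredT (0 : 'I_3)).
have vE' : v = pi ^+ k i *: \row_j (u j * pi ^+ (k j - k i)).
  by apply/rowP => j; rewrite !mxE vE mulrCA -exprD subnKC // mini.
have [kr|rk] := ltnP (k i) r; [right|left].
  exists (k i), (\row_j (u j * pi ^+ (k j - k i))); split=> //.
  by apply/primitiveP; exists i; rewrite mxE subnn expr0 mulr1.
by rewrite vE' (eqP (_ : pi ^+ k i == 0)) ?scale0r // piX_eq0.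
Qed.

(** GL_3(R) acts transitively on the primitive vectors. *)
Lemma primitive_trans v : primitive v ->
  exists2 M, M \in unitmx & delta_mx 0 0 *m M = v.
Proof.
case/primitiveP => i Uv.
(* The identity matrix with row i replaced by v, and its inverse 1 + d^T b. *)
pose d : 'rV[R]_3 := delta_mx 0 i; pose a := v - d; pose b := - (v 0 i)^-1 *: a.
have ad : a *m d^T = (v 0 i - 1)%:M.
  apply/matrixP => x y; rewrite !ord1 mxE (bigD1 i) //= big1 => [|j ji].
    by rewrite !mxE !eqxx addr0 mulr1 mulr1n.
  by rewrite !mxE (negPf ji) andbF mulr0.
have UM : 1%:M + d^T *m a \in unitmx.
  apply: (proj1 (mulmx1_unit (_ : _ *m (1%:M + d^T *m b) = 1%:M))).
  rewrite mulmxDl mul1mx mulmxDr mulmx1 -mulmxA (mulmxA a) ad mul_scalar_mx.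
  rewrite -addrA addrA -[RHS]addr0 -addrA; congr (_ + _).
  rewrite addrCA -!mulmxDr /b scalerA -scalerDl -[X in X + _]scale1r -scalerDl.
  rewrite (_ : 1 + _ = 0) ?scale0r ?mulmx0 //.
  by rewrite mulrN mulrBl divrr // mul1r; ring.
exists (tperm_mx 0 i *m (1%:M + d^T *m a)).
  by rewrite unitmx_mul unitmx_perm UM.
rewrite mulmxA (_ : delta_mx 0 0 *m tperm_mx 0 i = d); last first.
  by apply/rowP => j; rewrite -rowE !mxE tpermL eq_sym.
rewrite mulmxDr mulmx1 mulmxA (_ : d *m d^T = 1%:M) ?mul1mx ?subrKC //.
by apply/matrixP => x y; rewrite !ord1 -rowE !mxE !eqxx.
Qed.

(** The number of primitive u with u /\ v = 0. *)
Definition num_parallel (v : 'rV[R]_3) : nat :=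
  #|[set u : 'rV[R]_3 | primitive u & wedge u v == 0]|.

(* The value of [num_parallel] at pi ^+ k times any primitive vector. *)
Local Notation par k := (num_parallel (pi ^+ k *: delta_mx 0 0)).

Lemma num_parallel_mul v M : M \in unitmx ->
  num_parallel (v *m M) = num_parallel v.
Proof.
move=> UM; have UM' : invmx M \in unitmx by rewrite unitmx_inv.
rewrite /num_parallel -[LHS](card_imset _ (can_inj (mulmxK UM'))).
apply: eq_card => u; rewrite inE; apply/imsetP/andP => [[w]|[pu wu]].
  rewrite inE => /andP[pw ww] ->; rewrite primitive_mul // pw; split=> //.
  by rewrite -(wedge_mul_eq0 _ _ UM) mulmxKV.
exists (u *m M); last by rewrite mulmxK.
by rewrite inE primitive_mul // wedge_mul_eq0 // pu.
Qed.

Lemma num_parallel_primitive k v : primitive v ->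
  num_parallel (pi ^+ k *: v) = par k.
Proof.
by case/primitive_trans => M UM <-; rewrite scalemxAl num_parallel_mul.
Qed.

Lemma par_leS k : (par k <= par k.+1)%N.
Proof.
rewrite /num_parallel; apply: subset_leq_card; apply/subsetP => u;
  rewrite !inE => /andP[-> /eqP w0].
by rewrite exprS -scalerA wedgeZr w0 scaler0 eqxx.
Qed.

Lemma par_lt : (par r.-1 < par r)%N.
Proof.
rewrite /num_parallel; apply: proper_card; apply/properP; split.
  apply/subsetP => u; rewrite !inE => /andP[-> _].
  by rewrite pir0 scale0r wedge0r eqxx.
exists (delta_mx 0 1); rewrite !inE.
  rewrite pir0 scale0r wedge0r eqxx andbT.
  by apply/primitiveP; exists 1; rewrite mxE !eqxx unitr1.
apply: (contraNN _ s_neq0) => /andP[_ /eqP/matrixP/(_ 1 0)].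
by rewrite wedgeE !mxE !eqxx /= mul1r mulr1 mulr0 subr0 => ->.
Qed.

(** Abel summation: [num_parallel] is a combination with nonnegative
    coefficients of the indicators of the submodules pi ^+ k.+1 *: R^3. *)
Lemma num_parallelE v : num_parallel v =
  (par 0 + \sum_(k < r) (par k.+1 - par k) * (pi ^+ (r - k.+1) *: v == 0)%R)%N.
Proof.
have tele l : (l <= r)%N ->
    par l = (par 0 + \sum_(k < r) (par k.+1 - par k) * (k < l))%N.
  move=> lr; transitivity (par 0 + \sum_(0 <= k < l) (par k.+1 - par k))%N.
    rewrite (@telescope_sumn_in 0 l (fun k => par k)) //.
      by rewrite subnKC //; elim: l {lr} => // l IH;
        apply: leq_trans (par_leS l).
    by move=> i _; apply: par_leS.
  congr addn; rewrite big_mkord.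
  rewrite (big_ord_widen _ (fun k => par k.+1 - par k)%N lr) big_mkcond /=.
  by apply: eq_bigr => k _; case: ifP; rewrite ?muln1 ?muln0.
(* The zero vector corresponds to l = r. *)
have [->|[l [v0 [lr pv0 ->]]]] := vector_factor v.
  have -> : num_parallel 0 = par r by rewrite pir0 scale0r.
  rewrite (tele r) //.
  by congr addn; apply: eq_bigr => k _; rewrite scaler0 eqxx ltn_ord.
rewrite num_parallel_primitive // (tele l) ?(ltnW lr) //; congr addn.
apply: eq_bigr => k _; rewrite scalerA -exprD piX_primitive //.
congr (_ * nat_of_bool _)%N.
by rewrite -(leq_add2l (r - k.+1) k.+1 l) subnK.
Qed.

(** * Summation over all primitive vectors *)

Implicit Types g x : {'GL_2[R]}.

Lemma cent1_wedge x g :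
  (g \in 'C[x]%g) = (wedge (vec (GLval x)) (vec (GLval g)) == 0).
Proof.
apply/cent1P/eqP => [gx|/comm_wedge xg].
  by apply/comm_wedge; exact: (congr1 (@GLval 2 R) (esym gx)).
by apply: val_inj; exact: esym xg.
Qed.

(** The matrices g such that c *: g is scalar. For c = pi ^+ (r - k) these are
    the matrices that are scalar modulo pi ^+ k. *)
Definition congr_set (c : R) : {set {'GL_2[R]}} :=
  [set g : {'GL_2[R]} | c *: vec (GLval g) == 0].

Lemma congr_setP c g :
  reflect (exists a, c *: GLval g = (c * a)%:M) (g \in congr_set c).
Proof. by rewrite inE; apply: (iffP eqP) => /vec_scale_eq0. Qed.

Lemma congr_set_group c : group_set (congr_set c).
Proof.
apply/group_setP; split=> [|g h /congr_setP[a ga] /congr_setP[b hb]].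
  by apply/congr_setP; exists 1; rewrite GL_1E mulr1 scale_scalar_mx mulr1.
apply/congr_setP; exists (a * b); rewrite GL_MxE scalemxAl ga mul_scalar_mx.
by rewrite mulrC -scalerA hb scale_scalar_mx mulrCA mulrA.
Qed.
Canonical congr_group c := Group (congr_set_group c).

Lemma congr_norm c x : x \in 'N(congr_set c)%g.
Proof.
rewrite inE; apply/subsetP => _ /imsetP[g /congr_setP[a ga] ->].
apply/congr_setP; exists a; rewrite conjgE !GL_MxE scalemxAr scalemxAl ga.
by rewrite -scalar_mxC mulmxA -GL_MxE mulVg GL_1E mul1mx.
Qed.

Lemma congr_normal c (G : {group {'GL_2[R]}}) : (G :&: congr_set c <| G)%g.
Proof.
rewrite /normal subsetIl /= normsI ?normG //.
by apply/subsetP => x _; apply: congr_norm.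
Qed.

Lemma sum_wedge (A : {set {'GL_2[R]}}) (P : pred 'rV[R]_3)
    (v : {'GL_2[R]} -> 'rV[R]_3) (f : {'GL_2[R]} -> algC) :
  \sum_(u | P u) \sum_(g in A | wedge u (v g) == 0) f g
  = \sum_(g in A) f g *+ #|[set u | P u & wedge u (v g) == 0]|.
Proof.
rewrite (exchange_big_dep (mem A)) /=; last by move=> u g _ /andP[].
apply: eq_bigr => g Ag; rewrite -sumr_const; apply: eq_bigl => u.
by rewrite inE Ag.
Qed.

(** The sum over all primitive u is a combination with nonnegative coefficients
    of sums of chi over congruence subgroups. The smallest of these is that of
    [congr_set c], and its coefficient is positive. *)
Lemma sum_parallel_gt0 (G : {group {'GL_2[R]}}) (chi : 'CF(G)) (c : R) :
    chi \is a character -> 0 < \sum_(g in G :&: congr_set c) chi g ->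
  0 < \sum_(u | primitive u)
        \sum_(g in G | wedge u (c *: vec (GLval g)) == 0) chi g.
Proof.
move=> Nchi Hgt0; rewrite sum_wedge.
under eq_bigr => g _.
  rewrite -/(num_parallel _) num_parallelE mulrnDr -sumrMnr; over.
rewrite big_split /=; apply: ltr_wpDl.
  rewrite sumrMnl mulrn_wge0 // sum_char_ge0 //.
rewrite exchange_big /=.
have E (k : 'I_r) : \sum_(g in G) chi g *+
      ((par k.+1 - par k) * (pi ^+ (r - k.+1) *: (c *: vec (GLval g)) == 0))
    = (\sum_(g in G :&: congr_set (pi ^+ (r - k.+1) * c)) chi g)
        *+ (par k.+1 - par k).
  rewrite -sumrMnl big_mkcond [RHS]big_mkcond; apply: eq_bigr => g _.
  rewrite !inE scalerA; case: (g \in G) => //=.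
  by case: eqP; rewrite ?muln1 ?muln0.
under eq_bigr do rewrite E.
(* The summand k = r - 1 is the one that involves [congr_set c] itself. *)
have kr : (r.-1 < r)%N by rewrite prednK.
rewrite (bigD1 (Ordinal kr)) //=; apply: ltr_pwDl.
  rewrite prednK // subnn expr0 mul1r pmulrn_lgt0 // subn_gt0 ?par_lt //.
apply: sumr_ge0 => k _; rewrite mulrn_wge0 //.
by apply: sum_char_ge0; rewrite ?subsetIl.
Qed.

(** It is enough that, for each primitive u, the elements parallel to u up to
    the factor c form a centralizer. *)
Lemma conj_char_parallel (G : {group {'GL_2[R]}}) (i : Iirr G) (c : R) :
    0 < \sum_(g in G :&: congr_set c) 'chi_i g ->
    (forall u, primitive u -> exists2 x, x \in G &
      forall g, (g \in 'C[x]%g) = (wedge u (c *: vec (GLval g)) == 0)) ->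
  i \in irr_constt (conj_char G).
Proof.
move=> /(sum_parallel_gt0 (irr_char i)) Sgt0 Gu; apply: contraLR Sgt0 => ni.
rewrite big1 ?ltxx // => u /Gu[x Gx xE].
apply: etrans (conj_char_cent1 ni Gx); apply: eq_bigl => g.
by rewrite in_setI xE.
Qed.

Lemma congr1_sub_center (G : {group {'GL_2[R]}}) :
  (G :&: congr_set 1%R \subset 'Z(G))%g.
Proof.
rewrite subsetI subsetIl /=.
apply/subsetP => g /setIP[_ gc]; apply/centP => x _; apply/commute_sym/cent1P.
by move: gc; rewrite inE scale1r cent1C cent1_wedge => /eqP->; rewrite wedge0r.
Qed.

Lemma sum_center_gt0 (G : {group {'GL_2[R]}}) (i : Iirr G) :
  ('Z(G) \subset cfker 'chi_i)%g -> 0 < \sum_(g in G :&: congr_set 1) 'chi_i g.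
Proof.
move=> Zi.
refine (@sum_char_triv _ G (G :&: congr_group 1%R)%G 'chi_i (irr_char i)
  (irr_neq0 i) _).
exact: subset_trans (congr1_sub_center G) Zi.
Qed.

Lemma unit_near (x y : R) : s * x = s * y ->
  (x \is a GRing.unit) = (y \is a GRing.unit).
Proof. by rewrite !unit_socle => ->. Qed.

(** * Elements with a prescribed vector *)

(* The residue characteristic is odd. *)
Hypothesis U2 : (2%:R : R) \is a GRing.unit.

(** Every vector is that of an invertible matrix. *)
Lemma GL_centralizer u : exists x : {'GL_2[R]},
  forall g, (g \in 'C[x]%g) = (wedge u (1 *: vec (GLval g)) == 0).
Proof.
pose M d : 'M[R]_2 := mx2 (d + u 0 2%:R) (u 0 0) (u 0 1) d.
(* The determinant is a quadratic polynomial in d with leading coefficient 1. It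
   cannot vanish modulo pi at 0, 1 and -1, as the sum of its values at 1 and -1
   minus twice its value at 0 is 2. *)
have [d Ud] : exists d, M d \is a GRing.unit.
  have detE d : \det (M d) = d ^+ 2 + d * u 0 2%:R - u 0 0 * u 0 1.
    by rewrite det_mx2; ring.
  have UM d : (\det (M d) \is a GRing.unit) = (M d \is a GRing.unit).
    by rewrite -unitmxE.
  have [|/nonunitP] := boolP (\det (M 0) \is a GRing.unit).
    by rewrite UM; exists 0.
  have [|/nonunitP] := boolP (\det (M 1) \is a GRing.unit).
    by rewrite UM; exists 1.
  have [|/nonunitP] := boolP (\det (M (- 1)) \is a GRing.unit).
    by rewrite UM; exists (- 1).
  rewrite !detE => h3 h1 h0; have := unit_socle 2%:R; rewrite U2.
  set e := u 0 2%:R in h0 h1 h3; set p := u 0 0 * u 0 1 in h0 h1 h3.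
  suff -> : s * 2%:R = 0 by rewrite eqxx.
  transitivity (s * (1 ^+ 2 + 1 * e - p) + s * ((- 1) ^+ 2 + - 1 * e - p)
    - 2%:R * (s * (0 ^+ 2 + 0 * e - p))); first by ring.
  by rewrite h0 h1 h3; ring.
have vu : vec (M d) = u by apply: row3P; rewrite !vecE !mxE //=; ring.
by exists (FinRing.Unit Ud) => g; rewrite cent1_wedge scale1r -[in RHS]vu.
Qed.

(** The discriminant, divided by 4, of the characteristic polynomial of the
    matrices with vector u. *)
Definition disc (u : 'rV[R]_3) := u 0 0 * u 0 1 + (u 0 2%:R / 2%:R) ^+ 2.

(** The rational parametrization of the conic t^2 - D l^2 = 1. Here t and l are
    the coordinates of the point when v is the inverse of 1 - D m^2. *)
Lemma norm1_param (a b h m v : R) :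
  let D := a * b + h ^+ 2 in
  let t := (1 + D * m ^+ 2) * v in let l := 2%:R * m * v in
  (t + l * h) * (t - l * h) - l * a * (l * b) = ((1 - D * m ^+ 2) * v) ^+ 2.
Proof.
move=> D t l; transitivity (t ^+ 2 - l ^+ 2 * D); first by rewrite /D; ring.
have aux (e : R) : ((1 + e * m ^+ 2) * v) ^+ 2 - (2%:R * m * v) ^+ 2 * e
    = ((1 - e * m ^+ 2) * v) ^+ 2 by ring.
exact: aux.
Qed.

(** The point of the conic with parameter m yields an element of SL_2 whose
    vector is a unit multiple of m *: u. *)
Lemma SL_centralizer u m : 1 - disc u * m ^+ 2 \is a GRing.unit ->
  exists2 x : {'GL_2[R]}, x \in 'SL_2[R]%g &
  forall g, (g \in 'C[x]%g) = (wedge u (m *: vec (GLval g)) == 0).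
Proof.
set D := disc u => Uq; set q := 1 - D * m ^+ 2 in Uq.
pose t := (1 + D * m ^+ 2) / q; pose l := 2%:R * m / q.
pose A : 'M[R]_2 := mx2 (t + l * (u 0 2%:R / 2%:R)) (l * u 0 0) (l * u 0 1)
   (t - l * (u 0 2%:R / 2%:R)).
have detA : \det A = 1.
  by rewrite det_mx2 norm1_param ?divrr ?expr1n.
have UA : A \is a GRing.unit.
  by rewrite -[_ \is a _]/(A \in unitmx) unitmxE detA unitr1.
exists (FinRing.Unit UA); first by rewrite inE detA.
move=> g; rewrite cent1_wedge /=.
have -> : vec A = l *: u.
  apply: row3P; rewrite !vecE !mxE //=.
  transitivity (l * (u 0 2%:R / 2%:R * 2%:R)); first by ring.
  by rewrite divrK.
have Ul : 2%:R / q \is a GRing.unit by rewrite unitrM U2 unitrV.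
have -> : l = 2%:R / q * m by rewrite /l mulrAC.
rewrite -scalerA !wedgeZl wedgeZr; apply/eqP/eqP => [E|->];
  last by rewrite scaler0.
by rewrite -[LHS]scale1r -(mulVr Ul) -scalerA E scaler0.
Qed.

(** * SL2 over a ring with residue field of order 3 *)

(** The condition for [SL_centralizer] to apply with m = 1. *)
Definition good u := 1 - disc u \is a GRing.unit.

Lemma good_centralizer u : good u ->
  exists2 x : {'GL_2[R]}, x \in 'SL_2[R]%g &
  forall g, (g \in 'C[x]%g) = (wedge u (vec (GLval g)) == 0).
Proof.
move=> gu; have [|x Gx xE] := @SL_centralizer u 1;
  first by rewrite expr1n mulr1.
by exists x => // g; rewrite xE scale1r.
Qed.

Lemma discZ a u : disc (a *: u) = a ^+ 2 * disc u.
Proof. by rewrite /disc !mxE; ring. Qed.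

Lemma socle_disc u w : s *: u = s *: w -> s * disc u = s * disc w.
Proof.
move=> E; have e j : s * u 0 j = s * w 0 j.
  by have := congr1 (fun M : 'rV_3 => M 0 j) E; rewrite !mxE.
transitivity (s * u 0 0 * u 0 1 + s * u 0 2%:R * u 0 2%:R * 2%:R^-1 ^+ 2).
  by rewrite /disc; ring.
rewrite !e.
transitivity
  (w 0 0 * (s * u 0 1) + w 0 2%:R * (s * u 0 2%:R) * 2%:R^-1 ^+ 2).
  by ring.
by rewrite !e /disc; ring.
Qed.

Lemma good_socle u w : s *: u = s *: w -> good u = good w.
Proof.
by move=> /socle_disc E; apply: unit_near; rewrite !mulrBr E.
Qed.

Lemma socle_parallel u v0 : primitive v0 -> s *: wedge u v0 = 0 ->
  exists a, s *: u = s *: (a *: v0).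
Proof.
case/primitiveP => i Uv w0; exists (u 0 i / v0 0 i).
apply/rowP => j; rewrite !mxE.
have := congr1 (fun M : 'M_3 => M i j) w0.
rewrite [LHS]mxE wedgeE [RHS]mxE mulrBr => /subr0_eq E.
by rewrite -mulrA [_^-1 * _]mulrC !mulrA -[s * _ * _]mulrA E [v0 0 i * _]mulrC
  mulrA mulrK.
Qed.

Section ResidueF3.
(* Equivalently, the residue field has exactly three elements. *)
Hypothesis F3 : forall m, m \is a GRing.unit -> s * (m ^+ 2 - 1) = 0.

Lemma socle_sqr m : m \is a GRing.unit -> s * m ^+ 2 = s.
Proof. by move=> /F3/eqP; rewrite mulrBr mulr1 subr_eq0 => /eqP. Qed.

Lemma socle3 : s * 3%:R = 0.
Proof. by rewrite -(F3 U2); ring. Qed.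

Lemma socle_cases m : [\/ s * m = 0, s * m = s | s * m = - s].
Proof.
have [Um|/nonunitP ->] := boolP (m \is a GRing.unit); last by constructor 1.
have := F3 Um; have -> : m ^+ 2 - 1 = (m - 1) * (m + 1) by ring.
have [U1|/nonunitP h _] := boolP (m - 1 \is a GRing.unit).
  rewrite mulrCA => /(congr1 (fun y => (m - 1)^-1 * y));
    rewrite mulKr // mulr0 => h.
  by constructor 3; apply/eqP; rewrite -subr_eq0 opprK -{2}[s]mulr1 -mulrDr h.
by constructor 2; apply/eqP; rewrite -subr_eq0 -{2}[s]mulr1 -mulrBr h.
Qed.

Lemma good_parallel u v0 : primitive u -> primitive v0 ->
  s *: wedge u v0 = 0 -> good u = good v0.
Proof.
move=> pu pv /(socle_parallel pv)[a E].
have Ua : a \is a GRing.unit.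
  rewrite unit_socle; apply: contraNneq pu => sa0.
  by rewrite /primitive E scalerA sa0 scale0r.
apply: unit_near; rewrite !mulrBr (socle_disc E) discZ mulrA socle_sqr //.
Qed.

(** The number of good primitive u with u /\ v = 0. *)
Definition num_good_parallel v :=
  #|[set u : 'rV[R]_3 | primitive u && good u & wedge u v == 0]|.

(** A primitive vector parallel to v0 modulo pi is good exactly when v0 is. *)
Lemma num_good_parallelE l v0 : (l < r)%N -> primitive v0 ->
  num_good_parallel (pi ^+ l *: v0) = if good v0 then par l else 0%N.
Proof.
move=> lr pv.
have eg u : primitive u -> wedge u (pi ^+ l *: v0) == 0 -> good u = good v0.
  move=> pu /eqP w0; apply: good_parallel => //.
  have lr1 : (l <= r.-1)%N by rewrite -ltnS prednK.
  by rewrite -(subnK lr1) exprD -scalerA -wedgeZr w0 scaler0.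
case: ifP => gv; last first.
  apply: eq_card0 => u; rewrite !inE; apply/negP => /andP[/andP[pu gu] w0].
  by rewrite -(eg u pu w0) gu in gv.
rewrite -(num_parallel_primitive l pv); apply: eq_card => u; rewrite !inE.
apply/andP/andP => [[/andP[-> _] ->] //|[pu w0]].
by rewrite pu (eg u pu w0) gv.
Qed.

(** If pi *: v != 0 and v = pi ^+ l *: v0 with v0 primitive, then l < r - 1, and
    adding s *: w to v does not change v0 modulo pi. *)
Lemma num_good_parallel_near a v w : a \is a GRing.unit -> pi *: v != 0 ->
  num_good_parallel (a *: v + s *: w) = num_good_parallel v.
Proof.
move=> Ua; have [->|[l [v0 [lr pv ->]]]] := vector_factor v.
  by rewrite scaler0 eqxx.
rewrite scalerA -exprS piX_primitive // -ltnNge => lr1.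
have lr2 : (l < r.-1)%N by rewrite -ltnS prednK.
have -> : a *: (pi ^+ l *: v0) + s *: w =
  pi ^+ l *: (a *: v0 + pi ^+ (r.-1 - l) *: w).
  by rewrite scalerDr !scalerA -exprD subnKC 1?ltnW // mulrC.
set v1 := a *: v0 + _.
have sv1 : s *: v1 = s *: (a *: v0).
  by rewrite scalerDr scalerA socle_piX ?subn_gt0 // scale0r addr0.
have pv1 : primitive v1 by rewrite /primitive sv1 -/(primitive _) primitiveZ.
rewrite !num_good_parallelE // (good_socle sv1); congr (if _ then _ else _).
by apply: unit_near; rewrite !mulrBr discZ mulrA socle_sqr.
Qed.

Lemma row_socle_dvd (v : 'rV[R]_3) : pi *: v = 0 -> exists w, v = s *: w.
Proof.
move=> v0; have /fin_all_exists[w wE] j : exists y, v 0 j = s * y.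
  by apply: socle_dvd; have := congr1 (fun M : 'rV_3 => M 0 j) v0; rewrite !mxE.
by exists (\row_j w j); apply/rowP => j; rewrite !mxE.
Qed.

Lemma socle_sqr0 (v : 'rV[R]_3) : pi *: v != 0 -> s * s = 0.
Proof.
move=> pv; apply: socle_piX; rewrite -ltnS prednK //.
rewrite ltn_neqAle r_gt0 andbT; apply: contraNneq pv => r1.
by have := pir0; rewrite -r1 expr1 => ->; rewrite scale0r.
Qed.

Lemma num_good_parallel_coset g k : pi *: vec (GLval g) != 0 ->
  k \in congr_set pi ->
  num_good_parallel (vec (GLval (g * k)%g)) = num_good_parallel (vec (GLval g)).
Proof.
move=> pg; rewrite inE => /eqP/row_socle_dvd[w kw].
have ss0 := socle_sqr0 pg.
(* k is a scalar a plus s times Z. *)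
pose a := GLval k 1 1; pose Z := mx2 (w 0 2%:R) (w 0 0) (w 0 1) 0.
have e j : vec (GLval k) 0 j = s * w 0 j by rewrite kw mxE.
have kE : GLval k = a%:M + s *: Z.
  have := e 0; have := e 1; have := e 2%:R; rewrite !vecE => e2 e1 e0.
  apply: matrix2P; rewrite !mxE /= ?mulr1n ?mulr0n ?add0r ?mulr0 ?addr0 //.
  by rewrite -e2 addrC subrK.
have Ua : a \is a GRing.unit.
  have : s * \det (GLval k) != 0.
    by rewrite -unit_socle -unitmxE; exact: GL_unitmx.
  rewrite kE det2E !mxE /= ?mulr1n ?mulr0n ?add0r ?mulr0 ?addr0 => h.
  rewrite unit_socle; apply: contraNneq h => sa0; apply/eqP.
  transitivity ((s * a) * (a + s * w 0 2%:R) - (s * s) * (w 0 0 * (s * w 0 1))).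
    by ring.
  by rewrite sa0 ss0 !mul0r subrr.
have -> : vec (GLval (g * k)%g) = a *: vec (GLval g) + s *: vec (GLval g *m Z).
  by rewrite GL_MxE kE mulmxDr scalar_mxC mul_scalar_mx -scalemxAr vecD !vecZ.
exact: num_good_parallel_near.
Qed.

(** The matrix of trace zero with vector w. *)
Definition tvec (w : 'rV[R]_3) : 'M[R]_2 :=
  mx2 (w 0 2%:R / 2%:R) (w 0 0) (w 0 1) (- (w 0 2%:R / 2%:R)).

Lemma halfD (y : R) : y / 2%:R + y / 2%:R = y.
Proof. by rewrite -mulr2n -(mulr_natr (y / 2%:R) 2) divrK. Qed.

Lemma tvecZ a w : tvec (a *: w) = a *: tvec w.
Proof. by apply: matrix2P; rewrite !mxE //=; ring. Qed.

Lemma tvecD v w : tvec (v + w) = tvec v + tvec w.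
Proof. by apply: matrix2P; rewrite !mxE //=; ring. Qed.

Lemma det_tvec a w : \det (a%:M + tvec w) = a ^+ 2 - disc w.
Proof. by rewrite det2E !mxE /= ?mulr1n ?mulr0n ?add0r /disc; ring. Qed.

Lemma tvec_vec (A : 'M[R]_2) : A = ((A 0 0 + A 1 1) / 2%:R)%:M + tvec (vec A).
Proof.
apply: matrix2P; rewrite !mxE /= ?mulr1n ?mulr0n ?add0r //.
  by rewrite -[LHS]halfD; ring.
by rewrite -[LHS]halfD; ring.
Qed.

Definition row3 (a b c : R) : 'rV[R]_3 := \row_i [:: a; b; c]`_i.

Lemma row3D a b c a' b' c' :
  row3 a b c + row3 a' b' c' = row3 (a + a') (b + b') (c + c').
Proof. by apply: row3P; rewrite !mxE. Qed.

Lemma disc_row3 a b c : disc (row3 a b c) = a * b + (c / 2%:R) ^+ 2.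
Proof. by rewrite /disc !mxE. Qed.

Lemma primitive_row3 a b c :
  [|| a \is a GRing.unit, b \is a GRing.unit | c \is a GRing.unit] ->
  primitive (row3 a b c).
Proof.
by case/or3P => U; apply/primitiveP; [exists 0|exists 1|exists 2%:R];
  rewrite mxE.
Qed.

Lemma cube_root1 (b : algC) : b ^+ 3 = 1 -> b != 1 -> b ^+ 2 + b + 1 = 0.
Proof.
move=> b3 b1; have : (b - 1) * (b ^+ 2 + b + 1) = 0.
  by transitivity (b ^+ 3 - 1); [ring | rewrite b3 subrr].
by move/eqP; rewrite mulf_eq0 subr_eq0 (negPf b1) => /eqP.
Qed.

(** The values of f are cube roots of unity, and one of the six good vectors
    (1, 0, 0), (0, 1, 0), (1, -1, 0), (1, 1, 1), (1, -1, 1) and (-1, 1, 1) is in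
    its kernel. As f only depends on vectors modulo pi, and 3 = 0 modulo pi, the
    entries -1 are written as 2. *)
Lemma exists_good_trivial (f : 'rV[R]_3 -> algC) :
    {morph f : u w / u + w >-> u * w} -> (forall w, s *: w = 0 -> f w = 1) ->
  exists u, [/\ primitive u, good u & f u = 1].
Proof.
move=> fD f1.
have f3 u : f u ^+ 3 = 1.
  rewrite !exprS expr0 mulr1 -!fD; apply: f1.
  rewrite -[u]scale1r -!scalerDl scalerA.
  by rewrite (_ : s * _ = s * 3%:R) ?socle3 ?scale0r //; ring.
pose b := f (row3 1 0 0); pose c := f (row3 0 1 0); pose d := f (row3 0 0 1).
have b3 : b ^+ 3 = 1 := f3 _; have c3 : c ^+ 3 = 1 := f3 _.
have d3 : d ^+ 3 = 1 := f3 _.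
pose h : R := 2%:R^-1.
have Uh : h ^+ 2 \is a GRing.unit by rewrite unitrX ?unitrV.
have sh : s * h ^+ 2 = s by apply: socle_sqr; rewrite unitrV.
have g1 : good (row3 1 1 1).
  by rewrite /good disc_row3 (_ : 1 - _ = - h ^+ 2) ?unitrN // /h; ring.
have g2 (x y : R) : x * y = 2%:R -> good (row3 x y 1).
  move=> xy; rewrite /good disc_row3 xy (@unit_near _ (- 2%:R)) ?unitrN //.
  rewrite mul1r -/h; transitivity (- s - s * h ^+ 2); first by ring.
  by rewrite sh; ring.
have [b1|b1] := eqVneq b 1.
  exists (row3 1 0 0); split=> //.
    by apply: primitive_row3; rewrite unitr1.
  by rewrite /good disc_row3 mulr0 mul0r expr0n addr0 subr0 unitr1.
have [c1|c1] := eqVneq c 1.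
  exists (row3 0 1 0); split=> //.
    by apply: primitive_row3; rewrite unitr1 orbT.
  by rewrite /good disc_row3 !mul0r expr0n addr0 subr0 unitr1.
have bq := cube_root1 b3 b1; have cq := cube_root1 c3 c1.
have [cb|cb] := eqVneq c b.
  exists (row3 1 2%:R 0); split; first by apply: primitive_row3; rewrite unitr1.
    rewrite /good disc_row3 mul0r expr0n addr0 mul1r.
    by rewrite (_ : 1 - _ = - 1) ?unitrN1 //; ring.
  have -> : row3 1 2%:R 0 = row3 1 0 0 + row3 0 1 0 + row3 0 1 0.
    by rewrite !row3D ?addr0 ?add0r.
  by rewrite !fD -/b -/c cb -b3; ring.
have cE : c = b ^+ 2.
  have : (c - b) * (c - b ^+ 2) = 0.
    transitivity (c ^+ 2 - (b ^+ 2 + b + 1) * c + c + (b ^+ 3 - 1) + 1);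
      first by ring.
    by rewrite bq b3 subrr mul0r subr0 addr0.
  by move/eqP; rewrite mulf_eq0 subr_eq0 (negPf cb) subr_eq0 => /eqP.
have : (d - 1) * ((d - b) * (d - b ^+ 2)) = 0.
  transitivity (d ^+ 3 - 1 + (b ^+ 2 + b + 1) * (d - d ^+ 2)
    + (b ^+ 3 - 1) * (d - 1)); first by ring.
  by rewrite bq b3 d3 subrr !mul0r !addr0.
move/eqP; rewrite !mulf_eq0 !subr_eq0 => /or3P[] /eqP dE.
- exists (row3 1 1 1); split=> //.
    by apply: primitive_row3; rewrite unitr1.
  have -> : row3 1 1 1 = row3 1 0 0 + row3 0 1 0 + row3 0 0 1.
    by rewrite !row3D ?addr0 ?add0r.
  by rewrite !fD -/b -/c -/d dE cE mulr1 -b3; ring.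
- exists (row3 1 2%:R 1); split; [by apply: primitive_row3; rewrite unitr1| |].
    by apply: g2; rewrite mul1r.
  have -> : row3 1 2%:R 1 = row3 1 0 0 + row3 0 1 0 + row3 0 1 0 + row3 0 0 1.
    by rewrite !row3D ?addr0 ?add0r.
  rewrite !fD -/b -/c -/d dE cE; transitivity ((b ^+ 3) ^+ 2); first by ring.
  by rewrite b3 expr1n.
- exists (row3 2%:R 1 1); split; [by apply: primitive_row3; rewrite U2| |].
    by apply: g2; rewrite mulr1.
  have -> : row3 2%:R 1 1 = row3 1 0 0 + row3 1 0 0 + row3 0 1 0 + row3 0 0 1.
    by rewrite !row3D ?addr0 ?add0r.
  rewrite !fD -/b -/c -/d dE cE; transitivity ((b ^+ 3) ^+ 2); first by ring.
  by rewrite b3 expr1n.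
Qed.

(** The element 1 + s M of GL_2(R), where M has trace zero and vector w. The
    default value 1 is never used when s * s = 0. *)
Definition texp (w : 'rV[R]_3) : {'GL_2[R]} :=
  insubd (1%g : {'GL_2[R]}) (1%:M + s *: tvec w).

(* s * s = 0 means that r > 1. *)
Section Texp.
Hypothesis ss0 : s * s = 0.

Lemma det_socle t w : \det (t%:M + s *: tvec w) = t ^+ 2.
Proof. by rewrite -tvecZ det_tvec discZ (expr2 s) ss0 mul0r subr0. Qed.

Lemma texpE w : GLval (texp w) = 1%:M + s *: tvec w.
Proof.
rewrite -[GLval _]/(val (texp w)) insubdK //.
by rewrite -[_ \in _]/(_ \in unitmx) unitmxE det_socle expr1n unitr1.
Qed.

Lemma texpD u w : texp (u + w) = (texp u * texp w)%g.
Proof.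
apply: val_inj; rewrite /= -[RHS]/(GLval (texp u) *m GLval (texp w)) !texpE.
rewrite mulmxDl mul1mx mulmxDr mulmx1 -scalemxAl -scalemxAr scalerA ss0
  scale0r addr0.
by rewrite tvecD scalerDr -addrA [s *: tvec w + _]addrC.
Qed.

Lemma texp_eq1 w : s *: w = 0 -> texp w = 1%g.
Proof.
move=> sw; apply: val_inj; rewrite /= -[LHS]/(GLval _) texpE -tvecZ sw.
by rewrite -(scale0r 0) tvecZ scale0r addr0.
Qed.

Lemma eq_texp u w : s *: u = s *: w -> texp u = texp w.
Proof.
by move=> E; apply: val_inj; rewrite /= -!/(GLval _) !texpE -!tvecZ E.
Qed.

Lemma texp_SL w : texp w \in ('SL_2[R] :&: congr_set pi)%g.
Proof.
rewrite !inE texpE det_socle expr1n eqxx /=.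
by rewrite vecD vec_scalar add0r vecZ scalerA [pi * _]mulrC socle_pi scale0r.
Qed.

(** An element of SL_2(R) that is scalar modulo s is, up to a central factor,
    of the form [texp w]. *)
Lemma SL_congr_texp g w : g \in 'SL_2[R]%g -> vec (GLval g) = s *: w ->
  exists t, vec (GLval (g * (texp (t *: w))^-1)%g) = 0.
Proof.
rewrite inE => /eqP det1 gw.
set t := (GLval g 0 0 + GLval g 1 1) / 2%:R.
have gE : GLval g = t%:M + s *: tvec w by rewrite [LHS]tvec_vec gw tvecZ.
have t2 : t ^+ 2 = 1 by rewrite -det1 gE det_socle.
exists t.
have -> : GLval (g * (texp (t *: w))^-1)%g = t%:M.
  rewrite GL_MxE (_ : GLval g = t *: GLval (texp (t *: w))); last first.
    rewrite texpE gE tvecZ scalerDr !scalerA scale_scalar_mx mulr1.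
    by rewrite mulrCA -expr2 t2 mulr1.
  by rewrite -scalemxAl -GL_MxE mulgV GL_1E scale_scalar_mx mulr1.
exact: vec_scalar.
Qed.

(** The abelian group K has a linear character in the restriction of chi_i that
    is trivial on the elements of K parallel to some good u. *)
Lemma exists_good_sum (i : Iirr 'SL_2[R]%G) :
    ('Z('SL_2[R]) \subset cfker 'chi_i)%g ->
  exists u, [/\ primitive u, good u
    & 0 < \sum_(g in 'SL_2[R]%g :&: congr_set pi
                 | wedge u (vec (GLval g)) == 0) 'chi_i g].
Proof.
move=> Zi; pose K := ('SL_2[R] :&: congr_group pi)%G.
have sKG : K \subset 'SL_2[R]%g by apply: subsetIl.
have Kw g : g \in K -> exists w, vec (GLval g) = s *: w.
  by case/setIP => _; rewrite inE => /eqP/row_socle_dvd.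
have abK : abelian K.
  apply/centsP => g /Kw[w gw] h /Kw[w' hw]; apply/cent1P.
  by rewrite cent1_wedge gw hw wedgeZl wedgeZr scalerA ss0 scale0r.
have Nres : 'Res[K] 'chi_i \is a character by rewrite cfRes_char ?irr_char.
have [j jK] := constt_cfRes_irr K i.
have linj : 'chi_j \is a linear_char by apply/char_abelianP.
have ker1 z : z \in K -> vec (GLval z) = 0 -> 'chi_j z = 1.
  move=> Kz vz; rewrite -(lin_char1 linj) cfker1 //.
  apply: (subsetP (cfker_constt Nres jK));
    rewrite cfker_Res ?irr_char // inE Kz.
  apply: (subsetP Zi); apply: (subsetP (congr1_sub_center _)).
  by rewrite inE (subsetP sKG) // inE scale1r vz eqxx.
have KE w : texp w \in K by apply: texp_SL.
have [|w sw|u [pu gu fu]] := @exists_good_trivial (fun w => 'chi_j (texp w)).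
- by move=> u w /=; rewrite texpD lin_charM.
- by rewrite texp_eq1 // lin_char1.
exists u; split=> //.
have [x Gx xE] := good_centralizer gu.
rewrite (eq_bigl (mem (K :&: 'C[x])%G)); last by move=> g; rewrite [RHS]inE xE.
apply: (sum_char_constt (irr_char i) sKG (subsetIl _ _) jK).
(* Up to a central factor, g is [texp (t *: (a *: u))]. As s * (t * a) is one
   of 0, s and - s, this is a power of [texp u]. *)
apply/subsetP => g /setIP[Kg]; rewrite xE => /eqP w0.
rewrite cfkerEirr inE lin_char1 //; apply/eqP.
have [w gw] := Kw g Kg.
have [|a E] := @socle_parallel w u pu.
  by rewrite -wedgeC scalerN -wedgeZr -gw w0 oppr0.
have [t vz] := SL_congr_texp (subsetP sKG g Kg) (etrans gw E).
set x0 := texp _ in vz.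
have -> : 'chi_j g = 'chi_j x0.
  rewrite -[in LHS](mulgKV x0 g) lin_charM ?groupM ?groupV ?KE //.
  by rewrite (ker1 _ _ vz) ?mul1r // groupM ?groupV ?KE.
have chi0 : 'chi_j (texp 0) = 1 by rewrite texp_eq1 ?scaler0 // lin_char1.
case: (socle_cases (t * a)) => ta.
- by rewrite -chi0; congr ('chi_j _); apply: eq_texp;
    rewrite !scalerA -mulrA ta scale0r scaler0.
- by rewrite -fu; congr ('chi_j _); apply: eq_texp; rewrite !scalerA -mulrA ta.
rewrite -chi0 -[LHS]mulr1 -fu -lin_charM ?KE // -texpD; congr ('chi_j _).
apply: eq_texp; rewrite scalerDr !scalerA -mulrA ta scaler0 -scalerDl.
by rewrite addNr scale0r.
Qed.
End Texp.

(** All primitive vectors parallel to (1, 0, 0) are good, and (0, 1, 0) is a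
    good vector that is not parallel to it. *)
Lemma num_good0_gt : (par 0 < num_good_parallel 0)%N.
Proof.
have e0 : delta_mx 0 0 = row3 1 0 0 by apply: row3P; rewrite !mxE.
have p0 : primitive (row3 1 0 0) by apply: primitive_row3; rewrite unitr1.
have p1 : primitive (row3 0 1 0) by apply: primitive_row3; rewrite unitr1 orbT.
have g0 : good (row3 1 0 0).
  by rewrite /good disc_row3 mulr0 mul0r expr0n addr0 subr0 unitr1.
have g1 : good (row3 0 1 0).
  by rewrite /good disc_row3 !mul0r expr0n addr0 subr0 unitr1.
have := num_good_parallelE r_gt0 p0; rewrite g0 e0 => <-.
rewrite /num_good_parallel; apply: proper_card; apply/properP; split.
  by apply/subsetP => u; rewrite !inE => /andP[-> _]; rewrite wedge0r eqxx.
exists (row3 0 1 0); rewrite !inE p1 g1 /= ?wedge0r // expr0 scale1r.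
apply/negP => /eqP/matrixP/(_ 1 0); rewrite wedgeE !mxE /= mulr1 mulr0 subr0.
by move/eqP; rewrite oner_eq0.
Qed.

Lemma SL_irr_constt_F3 (i : Iirr 'SL_2[R]%G) :
  ('Z('SL_2[R]) \subset cfker 'chi_i)%g ->
    i \in irr_constt (conj_char 'SL_2[R]%G).
Proof.
move=> Zi; pose K := ('SL_2[R] :&: congr_group pi)%G.
have nKG : (K <| 'SL_2[R])%g by exact: congr_normal.
have sKG : K \subset 'SL_2[R]%g by apply: subsetIl.
(* Either chi_i sums to a positive number over K, and pi *: u can be used in
   place of u, or it sums to zero over all cosets of K. *)
have [SKgt0|SK0] := boolP (0 < \sum_(g in K) 'chi_i g).
  apply: (conj_char_parallel SKgt0) => u _; apply: SL_centralizer.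
  rewrite (@unit_near _ 1) ?unitr1 // mulrBr mulrCA expr2 (mulrA s) socle_pi.
  by rewrite mul0r mulr0 subr0.
have {}SK0 : \sum_(g in K) 'chi_i g = 0.
  apply/eqP; move: SK0; rewrite lt_def negb_and negbK.
  by rewrite (sum_char_ge0 sKG (irr_char i)) orbF.
apply: contraT => ni.
have good0 u : good u ->
    \sum_(g in 'SL_2[R]%g | wedge u (vec (GLval g)) == 0) 'chi_i g = 0.
  case/good_centralizer=> x Gx xE.
  by apply: etrans (conj_char_cent1 ni Gx); apply: eq_bigl => g;
    rewrite in_setI xE.
have sumF (A : {set {'GL_2[R]}}) :
    \sum_(u | primitive u && good u)
       \sum_(g in A | wedge u (vec (GLval g)) == 0) 'chi_i g
    = \sum_(g in A) 'chi_i g *+ num_good_parallel (vec (GLval g)).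
  exact: sum_wedge.
have sumG0 :
    \sum_(g in 'SL_2[R]%g) 'chi_i g *+ num_good_parallel (vec (GLval g)) = 0.
  by rewrite -sumF big1 // => u /andP[_ gu]; apply: good0.
(* When r = 1, K is the whole group, and a non-scalar element of SL_2(R) has a
   good vector: 1 - disc = 2 - t^2, where t is half the trace and t^2 is
   0 or 1. *)
have [r1|r1] := eqVneq r 1%N.
  have pi0 : pi = 0 by have := pir0; rewrite r1 expr1.
  have SG0 : \sum_(g in 'SL_2[R]%g) 'chi_i g = 0.
    rewrite -[RHS]SK0; apply: eq_bigl => g.
    by rewrite in_setI [g \in congr_set _]inE pi0 scale0r eqxx andbT.
  have s1 : s = 1 by rewrite r1 expr0.
  have FE g : g \in 'SL_2[R]%g -> num_good_parallel (vec (GLval g)) =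
      (par 0 + (num_good_parallel 0 - par 0) * (g \in congr_set 1%R))%N.
    move=> Gg; rewrite inE scale1r.
    have [->|nz] := eqVneq.
      by rewrite muln1 subnKC // ltnW // num_good0_gt.
    have pg : primitive (vec (GLval g)) by rewrite /primitive s1 scale1r.
    rewrite muln0 addn0 -[vec _]scale1r -(expr0 pi) num_good_parallelE //.
    rewrite (_ : good _) //; move: Gg; rewrite inE => /eqP.
    rewrite {1}[GLval g]tvec_vec det_tvec /good; set t := _ / _ => dt.
    have -> : 1 - disc (vec (GLval g)) = 2%:R - t ^+ 2.
      move: dt; set e := disc _ => dt.
      by transitivity (1 + (t ^+ 2 - e) - t ^+ 2); [ring | rewrite dt; ring].
    have := socle_cases t; rewrite s1 !mul1r => -[] ->.
    - by rewrite expr0n subr0.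
    - by rewrite expr1n (_ : _ - _ = 1) ?unitr1 //; ring.
    by rewrite sqrrN expr1n (_ : _ - _ = 1) ?unitr1 //; ring.
  suff : 0 <
      \sum_(g in 'SL_2[R]%g) 'chi_i g *+ num_good_parallel (vec (GLval g)).
    by rewrite sumG0 ltxx.
  rewrite (eq_bigr _ (fun g Gg => congr1 (fun n => 'chi_i g *+ n) (FE g Gg))).
  rewrite (eq_bigr _ (fun g _ => mulrnDr _ _ _)) big_split /= sumrMnl.
  rewrite SG0 mul0rn add0r.
  rewrite (_ : \sum_(g in _) _ =
    (\sum_(g in 'SL_2[R]%g :&: congr_set 1) 'chi_i g)
      *+ (num_good_parallel 0 - par 0)).
    by rewrite pmulrn_lgt0 ?sum_center_gt0 // subn_gt0 num_good0_gt.
  rewrite -sumrMnl big_mkcond [RHS]big_mkcond; apply: eq_bigr => g _.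
  rewrite in_setI; case: (g \in 'SL_2[R]%g) => //=.
  by case: (g \in _); rewrite ?muln1 ?muln0.
have ss0 : s * s = 0.
  by apply: socle_piX; rewrite -ltnS prednK // ltn_neqAle eq_sym r1.
have [u [pu gu]] := exists_good_sum ss0 Zi.
suff -> : \sum_(g in 'SL_2[R]%g :&: congr_set pi
                | wedge u (vec (GLval g)) == 0) 'chi_i g = 0.
  by rewrite ltxx.
have ge0 w : primitive w && good w ->
    0 <= \sum_(g in 'SL_2[R]%g :&: congr_set pi
              | wedge w (vec (GLval g)) == 0) 'chi_i g.
  case/andP=> _ /good_centralizer[x Gx xE].
  rewrite (eq_bigl (mem (K :&: 'C[x])%G)); last by move=> g;
    rewrite [RHS]inE xE.
  apply: sum_char_ge0; rewrite ?irr_char //;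
    exact: subset_trans (subsetIl _ _) sKG.
apply: (psumr_eq0P ge0); last by rewrite pu.
rewrite sumF.
(* Only K contributes to the sum of [sumG0]. *)
have out := sum_coset_const
  (F := fun g => num_good_parallel (vec (GLval g))) nKG SK0.
move: sumG0; rewrite (big_setID K) (setIidPr sKG) /= out ?addr0 //.
move=> g k Gg nKg Kk; apply: num_good_parallel_coset; last by case/setIP: Kk.
by apply: contra nKg => pg; rewrite inE Gg inE.
Qed.

End ResidueF3.

(** * GL2 and SL2 over a finite uniserial ring *)

(** If 1 - disc u is not a unit, then disc u is 1 modulo pi, and any unit m with
    m ^+ 2 != 1 modulo pi is a suitable parameter. *)
Lemma SL_irr_constt (i : Iirr 'SL_2[R]%G) :
  ('Z('SL_2[R]) \subset cfker 'chi_i)%g ->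
    i \in irr_constt (conj_char 'SL_2[R]%G).
Proof.
move=> Zi.
have [/existsP[m /andP[Um Um1]]|] :=
  boolP [exists m : R, (m \is a GRing.unit) && (m ^+ 2 - 1 \is a GRing.unit)].
  apply: (conj_char_parallel (sum_center_gt0 Zi)) => u _.
  have [U1|/nonunitP n1] := boolP (1 - disc u * 1 ^+ 2 \is a GRing.unit).
    exact: SL_centralizer.
  have Um2 : 1 - disc u * m ^+ 2 \is a GRing.unit.
    rewrite (@unit_near _ (- (m ^+ 2 - 1))) ?unitrN //.
    transitivity (s * - (m ^+ 2 - 1) + s * (1 - disc u * 1 ^+ 2) * m ^+ 2).
      by ring.
    by rewrite n1 mul0r addr0.
  have [x Gx xE] := SL_centralizer Um2; exists x => // g.
  rewrite xE !wedgeZr scale1r; apply/eqP/eqP => [E|->]; last by rewrite scaler0.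
  by rewrite -[LHS]scale1r -(mulVr Um) -scalerA E scaler0.
rewrite negb_exists => /forallP F3; apply: SL_irr_constt_F3 => // m Um.
by apply/nonunitP; have := F3 m; rewrite Um.
Qed.

Lemma GL_irr_constt (i : Iirr 'GL_2[R]%G) :
  ('Z('GL_2[R]) \subset cfker 'chi_i)%g ->
    i \in irr_constt (conj_char 'GL_2[R]%G).
Proof.
move=> Zi; apply: (conj_char_parallel (sum_center_gt0 Zi)) => u _.
by have [x xE] := GL_centralizer u; exists x; rewrite ?inE.
Qed.

End Uniserial.

(** * Quotients of discrete valuation rings *)

Section SumIdeal.
Variables (O : idomainType) (m : idealr O) (x : O).

(** The ideal generated by m and x. The proof argument, which keeps the instance
    below attached to it, makes it proper. *)
Definition in_sum_ideal (hx : ~ exists c, 1 - c * x \in m) : O -> bool :=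
  fun y => `[< exists c, y - c * x \in m >].

Hypothesis hx : ~ exists c, 1 - c * x \in m.

Lemma sum_ideal_closed : idealr_closed (in_sum_ideal hx).
Proof.
split.
- by apply/asboolP; exists 0; rewrite mul0r subr0 idealr0.
- by apply/negP => /asboolP.
- move=> d y z /asboolP[c yc] /asboolP[e ze]; apply/asboolP.
  exists (d * c + e); rewrite (_ : _ - _ = d * (y - c * x) + (z - e * x));
    last by ring.
  by rewrite rpredD // idealMr.
Qed.

HB.instance Definition _ := isIdealr.Build O (in_sum_ideal hx) sum_ideal_closed.

Definition sum_ideal : idealr O := in_sum_ideal hx.

End SumIdeal.

Lemma maximal_ideal_inv (O : idomainType) (m : idealr O) (x : O) :
  maximal_ideal m -> x \notin m -> exists c, 1 - c * x \in m.
Proof.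
move=> maxm xm; apply: contrapT => hx.
have /maxm/(_ x) : {subset m <= sum_ideal hx}.
  by move=> y ym; apply/asboolP; exists 0; rewrite mul0r subr0.
rewrite (negPf xm) => /esym/negbT/negP; apply.
by apply/asboolP; exists 1; rewrite mul1r subrr idealr0.
Qed.

Section DvrQuotUniserial.
Variables (O : idomainType) (m : idealr O) (hO : is_dvr m).
Variables (hfin : finite_residue m) (r : nat) (hr : (0 < r)%N).
Local Open Scope quotient_scope.
Local Notation Or := (dvr_quot hO hfin hr).

(** The reduction map from O to its quotient. *)
Definition proj : O -> Or := \pi_{ideal_quot ideal_pow m hr}.

Lemma projD : {morph proj : x y / x + y}.
Proof. by move=> x y; exact: (rmorphD \pi_{ideal_quot ideal_pow m hr}). Qed.

Lemma projM : {morph proj : x y / x * y}.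
Proof. by move=> x y; exact: (rmorphM \pi_{ideal_quot ideal_pow m hr}). Qed.

Lemma proj1 : proj 1 = 1.
Proof. exact: (rmorph1 \pi_{ideal_quot ideal_pow m hr}). Qed.

Lemma projB : {morph proj : x y / x - y}.
Proof. by move=> x y; exact: (rmorphB \pi_{ideal_quot ideal_pow m hr}). Qed.

Lemma proj0 : proj 0 = 0.
Proof. by rewrite -(subrr 0) projB subrr. Qed.

Lemma projX n : {morph proj : x / x ^+ n}.
Proof. by elim: n => [|n IH] x; rewrite ?proj1 // !exprS projM IH. Qed.

Lemma proj_eq0 x : (proj x == 0) = (x \in ideal_pow m hr).
Proof. by rewrite -proj0 -[in RHS](subr0 x) Quotient.idealrBE. Qed.

Lemma proj_surj (y : Or) : exists x, y = proj x.
Proof.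
by exists (repr (y : {ideal_quot ideal_pow m hr})); rewrite /proj reprK.
Qed.

(* a generates m. *)
Variable a : O.
Hypothesis ma : forall x, x \in m <-> exists y, x = y * a.

Lemma ideal_powP x : x \in ideal_pow m hr <-> exists y, x = y * a ^+ r.
Proof.
have am : a \in m by apply/ma; exists 1; rewrite mul1r.
have prodm (l : seq O) : all [in m] l ->
    exists v, \prod_(b <- l) b = v * a ^+ size l.
  elim: l => [_|b l IH /= /andP[/ma[c ->] /IH[v lE]]].
    by exists 1; rewrite big_nil mulr1.
  by exists (c * v); rewrite big_cons lE exprS; ring.
split=> [/asboolP[t [tm ->]]|[y ->]].
  rewrite big_seq; elim/big_rec: _ => [|u z /tm/prodm[v vE] [y ->]].
    by exists 0; rewrite mul0r.
  by rewrite size_tuple in vE; exists (u.1 * v + y); rewrite vE; ring.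
apply/asboolP; exists [:: (y, [tuple of nseq r a])]; split.
  by move=> u; rewrite inE => /eqP-> /=; rewrite all_nseq am orbT.
by rewrite big_seq1 /= big_nseq -Monoid.iteropE.
Qed.

Lemma proj_unit x : x \notin m -> proj x \is a GRing.unit.
Proof.
have [_ maxm _ _] := hO => /(maximal_ideal_inv maxm)[c /ma[d E]].
have nil : (proj (d * a)) ^+ r = 0.
  by rewrite -projX; apply/eqP; rewrite proj_eq0; apply/ideal_powP;
    exists (d ^+ r); rewrite exprMn.
have e : proj c * proj x = 1 - proj (d * a).
  by rewrite -projM -E -proj1 -projB; congr proj; ring.
(* 1 - d a is a unit in the quotient because d a is nilpotent there. *)
have := subrX1 (proj (d * a)) r; rewrite nil sub0r => /(congr1 -%R).
rewrite opprK -mulNr opprB -e mulrAC mulrC => E1.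
by apply/unitrPr; rewrite E1; eexists; reflexivity.
Qed.

Lemma dvr_quot_uniserial : a != 0 -> uniserial (proj a) r.
Proof.
move=> a0.
have am : a \in m by apply/ma; exists 1; rewrite mul1r.
have ar0 : proj a ^+ r = 0.
  by rewrite -projX; apply/eqP; rewrite proj_eq0; apply/ideal_powP; exists 1;
    rewrite mul1r.
split=> //.
  rewrite -projX proj_eq0; apply/negP => /ideal_powP[c E].
  have : a ^+ r.-1 * (1 - c * a) = 0.
    rewrite mulrBr mulr1 {1}E -{1}(prednK hr) exprS; ring.
  move/eqP; rewrite mulf_eq0 expf_eq0 (negPf a0) andbF /= subr_eq0 => /eqP E1.
  have := idealr1 m; rewrite E1 => /negbT/negP; apply; apply/ma; by exists c.
move=> y; have [x ->] := proj_surj y.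
have fac n : exists u k,
    [/\ (k <= n)%N, x = u * a ^+ k & (u \notin m) || (k == n)].
  elim: n => [|n [u [k [kn E /orP[um|/eqP kn1]]]]].
  - by exists x, 0%N; rewrite expr0 mulr1 eqxx orbT.
  - by exists u, k; rewrite um (leq_trans kn).
  have [/ma[v uE]|um] := boolP (u \in m); last by exists u, k;
    rewrite um (leq_trans kn).
  by exists v, n.+1; rewrite eqxx orbT E kn1 uE exprS mulrA.
have [u [k [kr -> /orP[um|/eqP->]]]] := fac r.
  by exists (proj u), k; rewrite projM projX; split=> //; apply: proj_unit.
by exists 1, r; rewrite unitr1 projM projX ar0 mul1r mulr0.
Qed.

Lemma dvr_quot_unit2 (p : nat) : p \in [pchar {ideal_quot m}] -> p != 2%N ->
  (2%:R : Or) \is a GRing.unit.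
Proof.
move=> /andP[pp /eqP p0] p2.
suff /proj_unit : 2%:R \notin m by rewrite projD proj1.
have pm : p%:R \in m.
  rewrite -[p%:R]subr0 Quotient.idealrBE; apply/eqP.
  by rewrite rmorph_nat p0 rmorph0.
have op : odd p by case: (even_prime pp) p2 => // ->.
apply/negP => m2; have := idealr1 m; move/negbT/negP; apply.
rewrite (_ : 1 = p%:R - (p./2)%:R * 2%:R); last first.
  by rewrite -{1}(odd_double_half p) op natrD -muln2 natrM addrK.
by rewrite rpredB // idealMr.
Qed.

End DvrQuotUniserial.

Theorem theorem6p18 (O : idomainType) (m : idealr O) (hO : is_dvr m)
    (hfin : finite_residue m)
    (p : nat) (hp : p \in [pchar {ideal_quot m}]) (hp2 : p != 2%N)
    (r : nat) (hr : (0 < r)%N)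
    (G : {group {'GL_2[dvr_quot hO hfin hr]}})
    (hG : G = 'GL_2[dvr_quot hO hfin hr]%G \/ G = 'SL_2[dvr_quot hO hfin hr]%G)
    (i : Iirr G) :
  'Z(G)%g \subset cfker 'chi_i -> i \in irr_constt (conj_char G).
Proof.
have [pid _ _ [x xm x0]] := hO; have [a ma] := pid m.
have a0 : a != 0.
  by apply: contraNneq x0 => a0; have /ma[y ->] := xm; rewrite a0 mulr0.
have hR := dvr_quot_uniserial hO hfin hr ma a0.
have U2 := dvr_quot_unit2 hO hfin hr ma hp hp2.
move: i; case: hG => -> i.
  exact: GL_irr_constt hR U2 i.
exact: SL_irr_constt hR U2 i.
Qed.
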